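(* Let $\lambda:B^{n-1}\to\Lambda^{2n-1}$ be a compact Legendre submanifold that is Lie-taut, and let $\alpha$ be a Lie sphere transformation. Then the Legendre submanifold $\alpha\lambda:B^{n-1}\to\Lambda^{2n-1}$ is also Lie-taut.
   Context: All manifolds and maps are smooth. $S^n$ is the unit sphere centered at the origin in $\mathbf{R}^{n+1}$, and $\cdot$ denotes the Euclidean inner product. $\beta(M;\mathbf{Z}_2)$ denotes the sum of the $\mathbf{Z}_2$-Betti numbers of a compact manifold $M$. Lie quadric: on $\mathbf{R}^{n+3}$ let $\langle x,y\rangle=-x_1y_1+x_2y_2+\cdots+x_{n+2}y_{n+2}-x_{n+3}y_{n+3}$. The Lie quadric is $Q^{n+1}=\{[x]\in\mathbf{P}^{n+2}:\langle x,x\rangle=0\}$, where $\mathbf{P}^{n+2}$ is real projective space. Vectors of $\mathbf{R}^{n+3}$ are written $(a,v,b)$ with $a,b\in\mathbf{R}$, $v\in\mathbf{R}^{n+1}$. $\Lambda^{2n-1}$ is the set of projective lines of $\mathbf{P}^{n+2}$ contained in $Q^{n+1}$. Let $T_1S^n=\{(p,\xi):p,\xi\in S^n,\ p\cdot\xi=0\}$ be the unit tangent bundle of $S^n$. The map $(p,\xi)\mapsto[(1,p,0),(0,\xi,1)]$ (the line through the two points) is a bijection $T_1S^n\to\Lambda^{2n-1}$, and $\Lambda^{2n-1}$ is given the differentiable structure making it a diffeomorphism. $\Lambda^{2n-1}$ carries the contact structure whose contact form corresponds on $T_1S^n$ to $\omega=dp\cdot\xi$. A Legendre submanifold is an immersed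 integral submanifold $\lambda:B^{n-1}\to\Lambda^{2n-1}$ of dimension $n-1$ of the distribution $\omega=0$. A Lie sphere transformation is a projective transformation of $\mathbf{P}^{n+2}$ mapping $Q^{n+1}$ to itself (the group of these is $O(n+1,2)/\{\pm I\}$, where $O(n+1,2)$ is the orthogonal group of $\langle\ ,\ \rangle$). It maps lines on $Q^{n+1}$ to lines on $Q^{n+1}$, so a Lie sphere transformation $\alpha$ induces a map of $\Lambda^{2n-1}$ to itself; $\alpha\lambda$ denotes the composition of this map with $\lambda$, which is again a Legendre submanifold. Lie-tautness: a compact Legendre submanifold $\lambda:B^{n-1}\to\Lambda^{2n-1}$ is Lie-taut if for almost every line $\ell\in\Lambda^{2n-1}$ (i.e. all except a set of measure zero in $\Lambda^{2n-1}$), the number of points $b\in B^{n-1}$ such that the line $\lambda(b)$ intersects the line $\ell$ is $\beta(B^{n-1};\mathbf{Z}_2)/2$. *)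

(* Defs.v *)
From HB Require Import structures.
From mathcomp Require Import all_boot all_order all_algebra.
From mathcomp Require Import all_classical all_reals all_analysis.

Set Implicit Arguments.
Unset Strict Implicit.
Unset Printing Implicit Defensive.

Import Order.TTheory GRing.Theory Num.Theory.
Import numFieldNormedType.Exports.

Local Open Scope classical_set_scope.
Local Open Scope card_scope.
Local Open Scope ring_scope.

(* All directional derivatives of order at most [k] exist and are continuous
   on [U]; for [U] open in a finite-dimensional space this is the usual C^k. *)
Fixpoint Ck_on (R : realType) (V W : normedModType R) (k : nat)
    (U : set V) (f : V -> W) : Prop :=
  (forall x, U x -> {for x, continuous f}) /\
  match k with
  | 0 => True
  | k'.+1 => forall v : V, (forall x, U x -> derivable f x v) /\
                           Ck_on k' U (fun x => 'D_v f x)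
  end.

Definition smooth_on (R : realType) (V W : normedModType R)
    (U : set V) (f : V -> W) : Prop :=
  forall k, Ck_on k U f.

(* Charts are encoded by total functions; only the values of [chart_map] on
   [chart_dom] and of [chart_inv] on [chart_cod] are meaningful. *)
Record chart (R : realType) (d : nat) (M : topologicalType) := Chart {
  chart_dom : set M;
  chart_map : M -> 'rV[R]_d;
  chart_inv : 'rV[R]_d -> M }.

Definition chart_cod (R : realType) (d : nat) (M : topologicalType)
    (c : chart R d M) : set 'rV[R]_d :=
  chart_map c @` chart_dom c.

Definition chart_homeo (R : realType) (d : nat) (M : topologicalType)
    (c : chart R d M) : Prop :=
  [/\ open (chart_dom c), open (chart_cod c),
      forall x, chart_dom c x -> chart_inv c (chart_map c x) = x,
      forall x, chart_dom c x -> {for x, continuous (chart_map c)} &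
      forall u, chart_cod c u -> {for u, continuous (chart_inv c)}].

Record manifold (R : realType) (d : nat) := Manifold {
  mcarrier :> topologicalType;
  atlas : set (chart R d mcarrier);
  manifold_hausdorff : hausdorff_space mcarrier;
  manifold_second_countable : @second_countable mcarrier;
  atlas_homeo : forall c, atlas c -> chart_homeo c;
  atlas_cover : forall x, exists2 c, atlas c & chart_dom c x;
  atlas_compatible : forall c c', atlas c -> atlas c' ->
    smooth_on (chart_map c @` (chart_dom c `&` chart_dom c'))
              (chart_map c' \o chart_inv c) }.

Arguments atlas {R d} _ _.

Definition smooth_map (R : realType) (d : nat) (M : manifold R d)
    (W : normedModType R) (f : M -> W) : Prop :=
  forall c, atlas M c -> smooth_on (chart_cod c) (f \o chart_inv c).

Definition immersion (R : realType) (d : nat) (M : manifold R d)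
    (W : normedModType R) (f : M -> W) : Prop :=
  smooth_map f /\
  forall c, atlas M c -> forall u, chart_cod c u -> forall v : 'rV[R]_d,
    'D_v (f \o chart_inv c) u = 0 -> v = 0.

Definition std_simplex (R : realType) (k : nat) : set 'rV[R]_k.+1 :=
  [set x | (forall i, 0 <= x ord0 i) /\ \sum_i x ord0 i = 1].

Arguments std_simplex : clear implicits.

Definition insert0 (R : realType) (k : nat) (i : 'I_k.+2) (x : 'rV[R]_k.+1) :
    'rV[R]_k.+2 :=
  \row_j oapp (x ord0) 0 (unlift i j).

Lemma insert0_simplex (R : realType) (k : nat) (i : 'I_k.+2)
    (x : 'rV[R]_k.+1) :
  std_simplex R k x -> std_simplex R k.+1 (insert0 i x).
Proof.
move=> [x0 x1]; split=> [j|].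
  by rewrite mxE; case: unliftP => //= j' _; exact: x0.
rewrite (bigD1_ord i) //= mxE unlift_none /= add0r -x1.
by apply: eq_bigr => j _; rewrite mxE liftK.
Qed.

Definition face (R : realType) (k : nat) (i : 'I_k.+2)
    (x : std_simplex R k) : std_simplex R k.+1 :=
  SigSub (mem_set (insert0_simplex i (set_valP x))).

(* A Z/2-chain is a finitely supported family of coefficients, concentrated
   on the continuous maps from the standard simplex. *)
Definition is_chain (R : realType) (X : topologicalType) (k : nat)
    (c : (std_simplex R k -> X) -> 'F_2) : Prop :=
  finite_set [set s | c s != 0] /\ forall s, c s != 0 -> continuous s.

Definition chain_boundary (R : realType) (X : topologicalType) (k : nat)
    (c : (std_simplex R k.+1 -> X) -> 'F_2) : (std_simplex R k -> X) -> 'F_2 :=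
  fun t => \sum_(s \in [set: std_simplex R k.+1 -> X])
             \sum_(i < k.+2) (if `[< s \o @face R k i = t >] then c s else 0).

Definition is_cycle (R : realType) (X : topologicalType) (k : nat) :
    ((std_simplex R k -> X) -> 'F_2) -> Prop :=
  match k with
  | 0 => fun c => is_chain c
  | k'.+1 => fun c => is_chain c /\ forall t, chain_boundary c t = 0
  end.

Definition is_boundary (R : realType) (X : topologicalType) (k : nat)
    (c : (std_simplex R k -> X) -> 'F_2) : Prop :=
  exists2 e : (std_simplex R k.+1 -> X) -> 'F_2,
    is_chain e & forall t, c t = chain_boundary e t.

(* The dimension of H_k(X; Z/2), as the supremum of the sizes of the families
   of cycles that are linearly independent modulo boundaries. *)
Definition betti (R : realType) (X : topologicalType) (k : nat) : \bar R :=
  ereal_sup [set (m%:R)%:E | m in [set m : nat |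
    exists c : 'I_m -> (std_simplex R k -> X) -> 'F_2,
      (forall j, is_cycle (c j)) /\
      forall a : 'I_m -> 'F_2,
        is_boundary (fun s => \sum_j a j * c j s) -> forall j, a j = 0]].

Definition total_betti (R : realType) (X : topologicalType) : \bar R :=
  (\sum_(0 <= k <oo) betti R X k)%E.

(* Vectors (a, v, b) of R^{n+3} = R x R^{n+1} x R. *)
Definition lie_vec (R : realType) (n : nat) : vectType R :=
  (R^o * 'rV[R]_n.+1 * R^o)%type.

Definition dot (R : realType) (m : nat) (v w : 'rV[R]_m) : R :=
  \sum_i v ord0 i * w ord0 i.

Definition lie_form (R : realType) (n : nat) (x y : lie_vec R n) : R :=
  - (x.1.1 * y.1.1) + dot x.1.2 y.1.2 - x.2 * y.2.

Definition proj_point (R : realType) (n : nat) : Type :=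
  {x : {vspace lie_vec R n} | \dim x == 1%N}.

Definition lie_quadric (R : realType) (n : nat) : set (proj_point R n) :=
  [set p : proj_point R n | forall x, x \in sval p -> lie_form x x = 0].

Arguments lie_quadric : clear implicits.

Definition projectivization (R : realType) (n : nat)
    (U : {vspace lie_vec R n}) : set (proj_point R n) :=
  [set p : proj_point R n | (sval p <= U)%VS].

(* A projective line when [x] and [y] are linearly independent. *)
Definition line_through (R : realType) (n : nat) (x y : lie_vec R n) :
    set (proj_point R n) :=
  projectivization (<[x]> + <[y]>)%VS.

Definition is_proj_line (R : realType) (n : nat) (l : set (proj_point R n)) :
    Prop :=
  exists2 U : {vspace lie_vec R n}, \dim U = 2%N & l = projectivization U.

Definition Lambda (R : realType) (n : nat) : set (set (proj_point R n)) :=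
  [set l | is_proj_line l /\ l `<=` lie_quadric R n].

Arguments Lambda : clear implicits.

Definition lie_sphere_transformation (R : realType) (n : nat)
    (alpha : proj_point R n -> proj_point R n) : Prop :=
  (exists2 A : 'End(lie_vec R n), lker A = 0%VS &
     forall p, sval (alpha p) = (A @: sval p)%VS) /\
  alpha @` lie_quadric R n = lie_quadric R n.

Definition unit_tangent (R : realType) (n : nat) :
    set ('rV[R]_n.+1 * 'rV[R]_n.+1) :=
  [set z | [/\ dot z.1 z.1 = 1, dot z.2 z.2 = 1 & dot z.1 z.2 = 0]].

(* The bijection from T_1 S^n to Lambda: the line through [(1, p, 0)] and
   [(0, xi, 1)]. *)
Definition contact_line (R : realType) (n : nat)
    (z : 'rV[R]_n.+1 * 'rV[R]_n.+1) : set (proj_point R n) :=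
  line_through ((1, z.1, 0) : lie_vec R n) ((0, z.2, 1) : lie_vec R n).

(* Inverses of the charts of T_1 S^n, seen as a submanifold of
   R^{n+1} x R^{n+1} of dimension 2n - 1. *)
Definition local_parametrization (R : realType) (n : nat)
    (U : set 'rV[R]_(2 * n).-1)
    (phi : 'rV[R]_(2 * n).-1 -> 'rV[R]_n.+1 * 'rV[R]_n.+1) : Prop :=
  [/\ open U, smooth_on U phi,
      forall u, U u -> forall v : 'rV[R]_(2 * n).-1,
        'D_v phi u = 0 -> v = 0,
      forall u u', U u -> U u' -> phi u = phi u' -> u = u' &
      forall V, open V -> V `<=` U ->
        exists2 O, open O & phi @` V = O `&` @unit_tangent R n].

Definition measure_zero (R : realType) (d : nat) (A : set 'rV[R]_d) : Prop :=
  forall e : R, 0 < e ->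
    exists a b : nat -> 'rV[R]_d,
      [/\ forall i j, a i ord0 j <= b i ord0 j,
          A `<=` \bigcup_i [set x | forall j, a i ord0 j <= x ord0 j
                                                <= b i ord0 j] &
          (\sum_(0 <= i <oo) (\prod_j (b i ord0 j - a i ord0 j))%:E < e%:E)%E].

(* Measure zero in the manifold Lambda: measure zero in every chart. *)
Definition Lambda_null (R : realType) (n : nat)
    (A : set (set (proj_point R n))) : Prop :=
  forall U (phi : 'rV[R]_(2 * n).-1 -> 'rV[R]_n.+1 * 'rV[R]_n.+1),
    local_parametrization U phi ->
    measure_zero [set u | U u /\ A (contact_line (phi u))].

(* [f] = (p, xi) is the map into T_1 S^n corresponding to [lambda], unique
   since [contact_line] is a bijection; smoothness, immersivity and the contact
   condition dp . xi = 0 are those of [f] because the differentiable and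
   contact structures of Lambda are transported from T_1 S^n. *)
Definition legendre (R : realType) (n : nat) (B : manifold R n.-1)
    (lambda : B -> set (proj_point R n)) : Prop :=
  exists f : B -> 'rV[R]_n.+1 * 'rV[R]_n.+1,
    [/\ forall b, unit_tangent (f b), forall b, lambda b = contact_line (f b),
        immersion f &
        forall c, atlas B c -> forall u, chart_cod c u ->
          forall v : 'rV[R]_n.-1,
            dot ('D_v (f \o chart_inv c) u).1 (f (chart_inv c u)).2 = 0].

(* For almost every line [l], the set of points [b] such that [lambda b] meets
   [l] is finite, of cardinality half the total Z/2-Betti number of [B]. *)
Definition lie_taut (R : realType) (n : nat) (B : manifold R n.-1)
    (lambda : B -> set (proj_point R n)) : Prop :=
  [/\ compact [set: B], legendre lambda &
      Lambda_null [set l | Lambda R n l /\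
        ~ exists2 m : nat,
            [set b | lambda b `&` l !=set0] #= `I_m &
            ((m%:R)%:E = total_betti R B * (2^-1)%:E)%E]].

(* The composition of [lambda] with the map on lines induced by [alpha]. *)
Definition lie_image (R : realType) (n : nat) (B : manifold R n.-1)
    (alpha : proj_point R n -> proj_point R n)
    (lambda : B -> set (proj_point R n)) : B -> set (proj_point R n) :=
  fun b => alpha @` lambda b.

(* Main.v *)
(* A Lie sphere transformation is induced by a linear bijection A preserving
   null vectors, hence scaling the Lie form. Solving a 2x2 system, the line
   spanned by A(1,p,0) and A(0,xi,1) is again of the form
   [(1,p',0)], [(0,xi',1)] with (p',xi') a rational function of (p,xi), whose
   denominator does not vanish on T_1 S^n. This gives a diffeomorphism of
   T_1 S^n, inverted by the map of A^-1; it preserves the contact condition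
   because dp'.xi' = <d(1,p',0), (0,xi',1)> and A scales the Lie form.
   Composing a local parametrization with that map gives another one, so
   the exceptional set of alpha lambda, read in the first chart, is contained in
   the exceptional set of lambda read in the second. *)
Require Import Defs.
From mathcomp Require Import all_boot all_order all_algebra.
From mathcomp Require Import all_classical all_reals all_analysis.
From mathcomp Require Import ring lra.

Set Implicit Arguments.
Unset Strict Implicit.
Unset Printing Implicit Defensive.

Import Order.TTheory GRing.Theory Num.Theory.
Import numFieldNormedType.Exports.

Local Open Scope classical_set_scope.
Local Open Scope ring_scope.

(** * Calculus with directional derivatives *)

Section Calculus.
Variables (R : realType) (V W : normedModType R).

(** A continuous linear [g] commutes with difference quotients and with their limit, so derivability
    of [f] in the single direction [v] suffices. *)
Lemma is_derive_linear (W' : normedModType R) (g : W -> W') (f : V -> W)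
    (x v : V) (df : W) :
  linear g -> continuous g -> is_derive x v f df ->
  is_derive x v (fun y => g (f y)) (g df).
Proof.
move=> glin gcont [fxv <-].
have gB a b : g (a - b) = g a - g b.
  by rewrite addrC -scaleN1r glin scaleN1r addrC.
have gZ k a : g (k *: a) = k *: g a.
  have g0 : g 0 = 0 by rewrite -(subrr 0) gB subrr.
  by rewrite -[k *: a]addr0 glin g0 addr0.
suff cv : (fun h => h^-1 *: (((fun y => g (f y)) \o shift x) (h *: v)
      - g (f x))) @ 0^' --> g ('D_v f x).
  by split; [apply/cvg_ex; eexists; exact: cv|exact: cvg_lim cv].
under eq_fun do rewrite /= -gB -gZ.
exact: (continuous_cvg _ (gcont _) fxv).
Qed.

Lemma is_derive_scale (a : V -> R) (w : V -> W) (x v : V) (da : R) (dw : W) :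
  is_derive x v a da -> is_derive x v w dw ->
  is_derive x v (fun y => a y *: w y) (a x *: dw + da *: w x).
Proof.
move=> [axv <-] [wxv <-].
suff cv : (fun h => h^-1 *: (((fun y => a y *: w y) \o shift x) (h *: v)
      - a x *: w x)) @ 0^' --> a x *: 'D_v w x + 'D_v a x *: w x.
  by split; [apply/cvg_ex; eexists; exact: cv|exact: cvg_lim cv].
have -> : (fun h => h^-1 *: (((fun y => a y *: w y) \o shift x) (h *: v)
      - a x *: w x)) =
    (fun h => a (h *: v + x) *: (h^-1 *: (w (h *: v + x) - w x)) +
              (h^-1 *: (a (h *: v + x) - a x)) *: w x).
  apply/funext => h /=; rewrite scalerA mulrC -!scalerA -scalerDr.
  congr (_ *: _).
  by rewrite scalerBr scalerBl addrA subrK.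
apply: cvgD; last exact: cvgZr_tmp axv.
apply: cvgZ wxv.
(* Derivability in direction [v] gives continuity of [a] along the line through [x], which is all
   this limit sees. *)
suff : {for 0, continuous (fun h : R => a (h *: v + x))}.
  by move=> /continuous_withinNx; rewrite scale0r add0r.
exact/differentiable_continuous/derivable1_diffP/(derivable1P _ _ _).1.
Qed.

Lemma is_derive_inv (a : V -> R) (x v : V) (da : R) :
  a x != 0 -> is_derive x v a da ->
  is_derive x v (fun y => (a y)^-1) (- (a x) ^- 2 * da).
Proof.
by move=> ax0 [axv <-]; split; [exact: derivableV|exact: deriveV].
Qed.

Lemma is_derive_pair (W' : normedModType R) (f : V -> W) (g : V -> W')
    (x v : V) (df : W) (dg : W') :
  is_derive x v f df -> is_derive x v g dg ->
  is_derive x v (fun y => (f y, g y)) (df, dg).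
Proof.
move=> [fxv <-] [gxv <-].
suff cv : (fun h => h^-1 *: (((fun y => (f y, g y)) \o shift x) (h *: v)
      - (f x, g x))) @ 0^' --> ('D_v f x, 'D_v g x).
  by split; [apply/cvg_ex; eexists; exact: cv|exact: cvg_lim cv].
exact: (cvg_pair fxv gxv).
Qed.

End Calculus.

(** * Stability of C^k functions under algebraic operations *)

Section CkClosure.
Variables (R : realType) (V : normedModType R).

Lemma Ck_on_pred (W : normedModType R) k (U : set V) (f : V -> W) :
  Ck_on k.+1 U f -> Ck_on k U f.
Proof.
elim: k f => [|k IH] f [fc fd]; first by split.
by split=> // v; have [fv /IH] := fd v.
Qed.

Lemma Ck_on_continuous (W : normedModType R) k (U : set V) (f : V -> W) x :
  Ck_on k U f -> U x -> {for x, continuous f}.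
Proof. by case: k => [|k] [fc _]; exact: fc. Qed.

Lemma Ck_on_derive (W : normedModType R) k (U : set V) (f : V -> W) x v :
  Ck_on k.+1 U f -> U x -> is_derive x v f ('D_v f x).
Proof. by move=> [_ /(_ v)[fd _]] /fd fxv; split. Qed.

Lemma Ck_on_ext (W : normedModType R) k (U : set V) (f g : V -> W) :
  open U -> (forall x, U x -> f x = g x) -> Ck_on k U f -> Ck_on k U g.
Proof.
move=> Uo; elim: k f g => [|k IH] f g fg;
  have near_fg x : U x -> \near x, f x = g x.
- by move=> Ux; apply: filterS (open_nbhs_nbhs (conj Uo Ux)).
- move=> [fc _]; split=> // x Ux; rewrite /prop_for /continuous_at -(fg _ Ux).
  by apply: cvg_trans (fc x Ux); apply: near_eq_cvg; exact: near_fg.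
- by move=> Ux; apply: filterS (open_nbhs_nbhs (conj Uo Ux)).
- move=> [fc fd]; split.
    move=> x Ux; rewrite /prop_for /continuous_at -(fg _ Ux).
    by apply: cvg_trans (fc x Ux); apply: near_eq_cvg; exact: near_fg.
  move=> v; have [fv Cv] := fd v; split.
    by move=> x Ux; apply: near_eq_derivable (fv x Ux); exact: near_fg.
  by apply: IH Cv => x Ux; apply: near_eq_derive; exact: near_fg.
Qed.

(** Inductive engine of the closure lemmas below: on an open set ['D_v f] may be replaced by an
    explicit formula that equals it there, by [Ck_on_ext]. *)
Lemma Ck_on_step (W : normedModType R) k (U : set V) (f : V -> W)
    (df : V -> V -> W) :
  open U -> (forall x, U x -> {for x, continuous f}) ->
  (forall x v, U x -> is_derive x v f (df v x)) ->
  (forall v, Ck_on k U (df v)) -> Ck_on k.+1 U f.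
Proof.
move=> Uo fc fd Cd; split=> // v; split.
  by move=> x Ux; have [] := fd x v Ux.
by apply: Ck_on_ext (Cd v) => // x Ux; have [_ ->] := fd x v Ux.
Qed.

Lemma Ck_on_cst (W : normedModType R) k (U : set V) (w : W) :
  open U -> Ck_on k U (fun=> w).
Proof.
move=> Uo; elim: k w => [|k IH] w; first by split=> // x _; exact: cvg_cst.
apply: (Ck_on_step (df := fun _ _ => 0)) => // x _; exact: cvg_cst.
Qed.

Lemma Ck_on_id k (U : set V) : open U -> Ck_on k U id.
Proof.
move=> Uo; case: k => [|k]; first by split=> // x _; exact: cvg_id.
apply: (Ck_on_step (df := fun v _ => v)) => // [x _|v]; first exact: cvg_id.
exact: Ck_on_cst.
Qed.

Lemma Ck_onD (W : normedModType R) k (U : set V) (f g : V -> W) :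
  open U -> Ck_on k U f -> Ck_on k U g -> Ck_on k U (fun x => f x + g x).
Proof.
move=> Uo; elim: k f g => [|k IH] f g Cf Cg.
  by split=> // x Ux; apply: cvgD;
    [exact: (Ck_on_continuous Cf Ux)|exact: (Ck_on_continuous Cg Ux)].
apply: (Ck_on_step (df := fun v x => 'D_v f x + 'D_v g x)) => //.
- by move=> x Ux; apply: cvgD;
    [exact: (Ck_on_continuous Cf Ux)|exact: (Ck_on_continuous Cg Ux)].
- by move=> x v Ux; apply: is_deriveD;
    [exact: (Ck_on_derive v Cf Ux)|exact: (Ck_on_derive v Cg Ux)].
- by move=> v; apply: IH; [have [_ /(_ v)[]] := Cf|have [_ /(_ v)[]] := Cg].
Qed.

Lemma Ck_on_linear (W W' : normedModType R) k (U : set V) (g : W -> W')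
    (f : V -> W) :
  open U -> linear g -> continuous g -> Ck_on k U f ->
  Ck_on k U (fun x => g (f x)).
Proof.
move=> Uo gl gc; have cgf j (h : V -> W) : Ck_on j U h ->
    forall x, U x -> {for x, continuous (fun x => g (h x))}.
  by move=> Ch x Ux; apply: continuous_comp;
    [exact: (Ck_on_continuous Ch Ux)|exact: gc].
elim: k f => [|k IH] f Cf; first by split=> //; exact: cgf Cf.
apply: (Ck_on_step (df := fun v x => g ('D_v f x))) => //.
- exact: cgf Cf.
- by move=> x v Ux; apply: is_derive_linear => //; exact: (Ck_on_derive v Cf Ux).
- by move=> v; apply: IH; have [_ /(_ v)[]] := Cf.
Qed.

Lemma Ck_onZ (W : normedModType R) k (U : set V) (a : V -> R^o) (w : V -> W) :
  open U -> Ck_on k U a -> Ck_on k U w -> Ck_on k U (fun x => a x *: w x).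
Proof.
move=> Uo; elim: k a w => [|k IH] a w Ca Cw.
  by split=> // x Ux; apply: cvgZ; [have := Ck_on_continuous Ca Ux|
                                    have := Ck_on_continuous Cw Ux].
apply: (Ck_on_step (df := fun v x => a x *: 'D_v w x + 'D_v a x *: w x)) => //.
- by move=> x Ux; apply: cvgZ; [have := Ck_on_continuous Ca Ux|
                                have := Ck_on_continuous Cw Ux].
- by move=> x v Ux; apply: is_derive_scale;
    [exact: (Ck_on_derive v Ca Ux)|exact: (Ck_on_derive v Cw Ux)].
(* In each term of the product rule one factor is undifferentiated; [Ck_on_pred] lowers its order to
   that of the induction hypothesis. *)
- move=> v; apply: Ck_onD => //; apply: IH.
  + exact: Ck_on_pred.
  + by have [_ /(_ v)[]] := Cw.
  + by have [_ /(_ v)[]] := Ca.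
  + exact: Ck_on_pred.
Qed.

Lemma Ck_on_inv k (U : set V) (a : V -> R^o) :
  open U -> (forall x, U x -> a x != 0) -> Ck_on k U a ->
  Ck_on k U (fun x => (a x)^-1 : R^o).
Proof.
move=> Uo a0; have ca j : Ck_on j U a ->
    forall x, U x -> {for x, continuous (fun x => (a x)^-1 : R^o)}.
  by move=> Ca x Ux; apply: cvgV; [exact: a0|exact: (Ck_on_continuous Ca Ux)].
elim: k => [|k IH] Ca; first by split=> //; exact: ca Ca.
(* The derivative -a'/a^2 is written as nested scalings so that [Ck_onZ] applies, the induction
   hypothesis serving for the factors 1/a. *)
apply: (Ck_on_step
  (df := fun v x => (-1 : R) *: ((a x)^-1 *: ((a x)^-1 *: 'D_v a x)) : R^o))
  => //.
- exact: ca Ca.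
- move=> x v Ux; have H := is_derive_inv (a0 x Ux) (Ck_on_derive v Ca Ux).
  by apply: (is_derive_eq (W := R^o) H); rewrite expr2 invfM /GRing.scale /=; ring.
- move=> v; have Cia : Ck_on k U (fun x => (a x)^-1 : R^o) by exact/IH/Ck_on_pred.
  apply: (Ck_onZ (a := fun=> -1)) => //; first exact: Ck_on_cst.
  do 2 apply: Ck_onZ => //.
  by have [_ /(_ v)[]] := Ca.
Qed.

Lemma Ck_on_pair (W W' : normedModType R) k (U : set V) (f : V -> W)
    (g : V -> W') :
  open U -> Ck_on k U f -> Ck_on k U g -> Ck_on k U (fun x => (f x, g x)).
Proof.
move=> Uo; elim: k f g => [|k IH] f g Cf Cg.
  by split=> // x Ux;
    exact: (cvg_pair (Ck_on_continuous Cf Ux) (Ck_on_continuous Cg Ux)).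
apply: (Ck_on_step (df := fun v x => ('D_v f x, 'D_v g x))) => //.
- by move=> x Ux;
    exact: (cvg_pair (Ck_on_continuous Cf Ux) (Ck_on_continuous Cg Ux)).
- by move=> x v Ux; apply: is_derive_pair; [exact: (Ck_on_derive v Cf Ux)|
                                            exact: (Ck_on_derive v Cg Ux)].
- by move=> v; apply: IH; [have [_ /(_ v)[]] := Cf|have [_ /(_ v)[]] := Cg].
Qed.

End CkClosure.

(** Expanded in the basis [delta_mx], [g] is a finite sum of coordinate functions times fixed
    vectors. *)
Lemma rV_linear_continuous (R : realType) m (W : normedModType R)
    (g : 'rV[R]_m -> W) : linear g -> continuous g.
Proof.
move=> gl.
have gZD c u w : g (c *: u + w) = c *: g u + g w by exact: gl.
have g0 : g 0 = 0.
  by have := gZD (-1) 0 0; rewrite scaler0 addr0 scaleN1r addNr.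
have -> : g = (fun x => \sum_(i < m) x ord0 i *: g (delta_mx ord0 i)).
  apply/funext => x; rewrite [in LHS](row_sum_delta x).
  elim/big_rec2: _ => // i y1 y2 _ <-; exact: gZD.
apply: continuous_big => [|i _ x]; first exact: add_continuous.
exact: cvgZr_tmp (@coord_continuous R 1 m ord0 i x).
Qed.

(** * The Lie form and contact elements *)

Section Dot.
Variables (R : realType) (m : nat).
Implicit Types u v w : 'rV[R]_m.

Lemma dotC u v : dot u v = dot v u.
Proof. by apply: eq_bigr => i _; rewrite mulrC. Qed.

Lemma dotDl u v w : dot (u + v) w = dot u w + dot v w.
Proof. by rewrite -big_split; apply: eq_bigr => i _; rewrite mxE mulrDl. Qed.

Lemma dotZl c u v : dot (c *: u) v = c * dot u v.
Proof. by rewrite mulr_sumr; apply: eq_bigr => i _; rewrite mxE mulrA. Qed.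

Lemma dotDr u v w : dot u (v + w) = dot u v + dot u w.
Proof. by rewrite dotC dotDl !(dotC u). Qed.

Lemma dotZr c u v : dot u (c *: v) = c * dot u v.
Proof. by rewrite dotC dotZl dotC. Qed.

Lemma dot0l u : dot 0 u = 0.
Proof. by rewrite -(scale0r 0) dotZl mul0r. Qed.

Lemma dot0r u : dot u 0 = 0.
Proof. by rewrite dotC dot0l. Qed.

Lemma dot_ge0 u : 0 <= dot u u.
Proof. by apply: sumr_ge0 => i _; rewrite -expr2 sqr_ge0. Qed.

Lemma dot_eq0 u : dot u u = 0 -> u = 0.
Proof.
move=> /eqP; rewrite psumr_eq0; last by move=> i _; rewrite -expr2 sqr_ge0.
move=> /allP u0; apply/rowP => i; rewrite mxE.
by have := u0 i (mem_index_enum i); rewrite mulf_eq0 orbb => /eqP.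
Qed.

End Dot.

Definition null_preserving (R : realType) (n : nat)
    (A : 'End(lie_vec R n)) : Prop :=
  forall x, lie_form x x = 0 -> lie_form (A x) (A x) = 0.

Section LieForm.
Variables (R : realType) (n : nat).
Implicit Types x y z : lie_vec R n.

Lemma lie_formC x y : lie_form x y = lie_form y x.
Proof. by rewrite /lie_form dotC (mulrC x.1.1) (mulrC x.2). Qed.

Lemma lie_formDl x y z : lie_form (x + y) z = lie_form x z + lie_form y z.
Proof. by rewrite /lie_form /= dotDl; ring. Qed.

Lemma lie_formZl c x y : lie_form (c *: x) y = c * lie_form x y.
Proof. by rewrite /lie_form /= dotZl /GRing.scale /=; ring. Qed.

Lemma lie_formDr x y z : lie_form x (y + z) = lie_form x y + lie_form x z.
Proof. by rewrite lie_formC lie_formDl !(lie_formC x). Qed.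

Lemma lie_formZr c x y : lie_form x (c *: y) = c * lie_form x y.
Proof. by rewrite lie_formC lie_formZl lie_formC. Qed.

Definition lie_formE := (lie_formDl, lie_formDr, lie_formZl, lie_formZr).

Lemma lie_vecE (a b : R) (v : 'rV[R]_n.+1) :
  ((a, v, b) : lie_vec R n) =
  a *: ((1, 0, 0) : lie_vec R n) + ((0, v, 0) : lie_vec R n)
    + b *: ((0, 0, 1) : lie_vec R n).
Proof.
by congr (_, _, _) => /=; rewrite ?scaler0 ?add0r ?addr0 // /GRing.scale /= mulr1.
Qed.

(* With [e0 = (1, 0, 0)] and [e1 = (0, 0, 1)], the vectors [+- s e0 + v] and
   [v +- s e1] with [s^2 = v . v], and [3 e0 + 5 u + 4 e1] with [u] a unit
   vector, are null; their images determine the pulled back form. *)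
Lemma lie_form_conformal (A : 'End(lie_vec R n)) :
  null_preserving A ->
  exists c, forall x y, lie_form (A x) (A y) = c * lie_form x y.
Proof.
move=> Anull.
pose e0 : lie_vec R n := (1, 0, 0); pose e1 : lie_vec R n := (0, 0, 1).
pose f v : lie_vec R n := (0, v, 0).
pose B x y := lie_form (A x) (A y).
have BQ a v b : B (a, v, b) (a, v, b) = a ^+ 2 * B e0 e0 + B (f v) (f v)
    + b ^+ 2 * B e1 e1 + 2 * a * B e0 (f v) + 2 * b * B e1 (f v)
    + 2 * a * b * B e0 e1.
  rewrite lie_vecE -/e0 -/e1 -/(f v) /B !linearD !linearZ /= !lie_formE.
  rewrite (lie_formC (A e1) (A e0)) (lie_formC (A (f v)) (A e0)).
  by rewrite (lie_formC (A (f v)) (A e1)); ring.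
have B0 a v b : - a ^+ 2 + dot v v - b ^+ 2 = 0 -> B (a, v, b) (a, v, b) = 0.
  by move=> h; apply: Anull; rewrite /lie_form /= -!expr2.
have f0 x : B x (f 0) = 0.
  suff -> : f 0 = 0 *: e0 by rewrite /B linearZ lie_formZr mul0r.
  by congr (_, _, _); rewrite /= ?scaler0 // /GRing.scale /= mul0r.
(* For null vectors differing in the sign of [s], the sum of the two equations gives the diagonal
   relation and the difference kills the cross term. *)
have key v s : s ^+ 2 = dot v v -> [/\ B (f v) (f v) = - s ^+ 2 * B e0 e0,
    B (f v) (f v) = - s ^+ 2 * B e1 e1, s * B e0 (f v) = 0 & s * B e1 (f v) = 0].
  move=> sv.
  have h1 : B (s, v, 0) (s, v, 0) = 0 by apply: B0; rewrite -sv; ring.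
  have h2 : B (- s, v, 0) (- s, v, 0) = 0 by apply: B0; rewrite -sv; ring.
  have h3 : B (0, v, s) (0, v, s) = 0 by apply: B0; rewrite -sv; ring.
  have h4 : B (0, v, - s) (0, v, - s) = 0 by apply: B0; rewrite -sv; ring.
  rewrite BQ in h1; rewrite BQ in h2; rewrite BQ in h3; rewrite BQ in h4.
  move: (B e0 e0) (B e1 e1) (B (f v) (f v)) (B e0 (f v)) (B e1 (f v)) (B e0 e1)
    h1 h2 h3 h4; clear - s => q0 q1 qf b0 b1 b01 h1 h2 h3 h4; split; lra.
have sq (v : 'rV[R]_n.+1) : Num.sqrt (dot v v) ^+ 2 = dot v v.
  by rewrite sqr_sqrtr // dot_ge0.
have orth v : B e0 (f v) = 0 /\ B e1 (f v) = 0.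
  have [_ _ h0 h1] := key v _ (sq v).
  (* At [s = 0] the cross-term equations of [key] are vacuous, but then [v = 0] by positive
     definiteness of [dot]. *)
  have [s0|s0] := eqVneq (Num.sqrt (dot v v)) 0.
    suff -> : v = 0 by rewrite !f0.
    by apply: dot_eq0; rewrite -sq s0 expr0n.
  by split; apply: (mulfI s0); rewrite mulr0.
pose u : 'rV[R]_n.+1 := delta_mx ord0 ord0.
have uu : dot u u = 1.
  rewrite /dot (bigD1 ord0) //= big1 ?addr0 => [|i i0].
    by rewrite !mxE eqxx mulr1.
  by rewrite !mxE (negbTE i0) mulr0.
have [h1 h2 _ _] : [/\ B (f u) (f u) = - 1 ^+ 2 * B e0 e0,
    B (f u) (f u) = - 1 ^+ 2 * B e1 e1, 1 * B e0 (f u) = 0 & 1 * B e1 (f u) = 0].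
  by apply: key; rewrite expr1n.
(* Since 3^2 + 4^2 = 5^2, a null vector with nonzero components along both [e0] and [e1] exists
   without extracting a root; it isolates [B e0 e1]. *)
have h01 : B e0 e1 = 0.
  have u5 : 5 ^+ 2 = dot (5 *: u) (5 *: u) by rewrite dotZl dotZr uu; ring.
  have := B0 3 (5 *: u) 4; rewrite -u5 BQ => /(_ ltac:(ring)).
  have [-> -> ] := orth (5 *: u); have [-> _ _ _] := key _ _ u5.
  move: h1 h2; move: (B (f u) (f u)) (B e0 e0) (B e1 e1) (B e0 e1).
  by clear - R => qf q0 q1 b01 h1 h2 h3; lra.
(* The factor is forced by [lie_form e0 e0 = -1]. *)
have Qc x : B x x = - B e0 e0 * lie_form x x.
  case: x => [[a v] b]; rewrite BQ h01; have [-> ->] := orth v.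
  have [-> _ _ _] := key v _ (sq v); rewrite sq /lie_form /= -!expr2.
  have -> : B e1 e1 = B e0 e0.
    by apply: oppr_inj; rewrite expr1n !mulN1r in h1 h2; rewrite -h1 -h2.
  by ring.
(* Polarization: the quadratic identity at [x], [y] and [x + y] gives the bilinear one. *)
exists (- B e0 e0) => x y; have := Qc (x + y); rewrite /B linearD !lie_formE.
have := Qc x; have := Qc y; rewrite /B => -> ->.
rewrite (lie_formC (A y)) (lie_formC y).
move: (lie_form (A x) (A y)) (lie_form x y) (lie_form x x) (lie_form y y) (B e0 e0).
by clear - R => a b p q r h; lra.
Qed.

End LieForm.

(** * Contact elements as two-dimensional subspaces *)

Section ContactSpace.
Variables (R : realType) (n : nat).
Implicit Types z w : 'rV[R]_n.+1 * 'rV[R]_n.+1.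

Definition point_vec (p : 'rV[R]_n.+1) : lie_vec R n := (1, p, 0).
Definition tangent_vec (xi : 'rV[R]_n.+1) : lie_vec R n := (0, xi, 1).

Definition contact_space z : {vspace lie_vec R n} :=
  (<[point_vec z.1]> + <[tangent_vec z.2]>)%VS.

Lemma contact_lineE z : contact_line z = projectivization (contact_space z).
Proof. by []. Qed.

Lemma contact_vecE (s t : R) z : s *: point_vec z.1 + t *: tangent_vec z.2 =
  ((s, s *: z.1 + t *: z.2, t) : lie_vec R n).
Proof.
by congr (_, _, _); rewrite /= /GRing.scale /= ?mulr1 ?mulr0 ?addr0 ?add0r.
Qed.

Lemma mem_contact_spaceP z x :
  reflect (exists s t, x = s *: point_vec z.1 + t *: tangent_vec z.2)
          (x \in contact_space z).
Proof.
apply: (iffP memv_addP) => [[_ /vlineP[s ->] [_ /vlineP[t ->] ->]]|].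
  by exists s, t.
move=> [s [t ->]]; exists (s *: point_vec z.1); first exact/memvZ/memv_line.
by exists (t *: tangent_vec z.2) => //; exact/memvZ/memv_line.
Qed.

(** The first and last coordinates of a vector of the plane are its coefficients on the two spanning
    vectors, so [z.1] and [z.2] can be read off from the plane. *)
Lemma contact_space_inj : injective contact_space.
Proof.
move=> z w zw.
have /mem_contact_spaceP[s [t]] : point_vec z.1 \in contact_space w.
  by rewrite -zw; apply/mem_contact_spaceP; exists 1, 0; rewrite scale1r scale0r addr0.
have /mem_contact_spaceP[s' [t']] : tangent_vec z.2 \in contact_space w.
  by rewrite -zw; apply/mem_contact_spaceP; exists 0, 1; rewrite scale1r scale0r add0r.
rewrite !contact_vecE => -[s0 e2 t1] [s1 e1 t0].
rewrite -s0 -t1 scale0r scale1r add0r in e2.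
rewrite -s1 -t0 scale0r scale1r addr0 in e1.
by case: z w {zw} e1 e2 => [z1 z2] [w1 w2] /= -> ->.
Qed.

Lemma lie_form_point p p' :
  lie_form (point_vec p) (point_vec p') = dot p p' - 1.
Proof. by rewrite /lie_form /=; ring. Qed.

Lemma lie_form_tangent q q' :
  lie_form (tangent_vec q) (tangent_vec q') = dot q q' - 1.
Proof. by rewrite /lie_form /=; ring. Qed.

Lemma lie_form_point_tangent p q :
  lie_form (point_vec p) (tangent_vec q) = dot p q.
Proof. by rewrite /lie_form /=; ring. Qed.

(** The Gram matrix of the spanning vectors has entries p.p - 1, xi.xi - 1 and p.xi, which all
    vanish. *)
Lemma contact_space_null z x : unit_tangent z -> x \in contact_space z ->
  lie_form x x = 0.
Proof.
move=> [z1 z2 z12] /mem_contact_spaceP[s [t ->]].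
rewrite !lie_formE (lie_formC (tangent_vec _) (point_vec _)).
by rewrite lie_form_point lie_form_tangent lie_form_point_tangent z1 z2 z12; ring.
Qed.

Lemma dim_contact_space z : \dim (contact_space z) = 2%N.
Proof.
have p0 : point_vec z.1 != 0 by apply/eqP => -[/eqP]; rewrite oner_eq0.
have q0 : tangent_vec z.2 != 0 by apply/eqP => -[_ /eqP]; rewrite oner_eq0.
rewrite /contact_space dimv_disjoint_sum ?dim_vline ?p0 ?q0 //.
apply/eqP; rewrite -subv0; apply/subvP => x; rewrite memv_cap.
move=> /andP[/vlineP[s ->] /vlineP[t]] => -[s0 _ _].
by rewrite /GRing.scale /= mulr1 mulr0 in s0; rewrite s0 scale0r mem0v.
Qed.

End ContactSpace.

(** * The action of a linear map on contact elements *)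

Section LieMap.
Variables (R : realType) (n : nat) (A : 'End(lie_vec R n)).
Implicit Types z w : 'rV[R]_n.+1 * 'rV[R]_n.+1.

Let P z := A (point_vec z.1).
Let X z := A (tangent_vec z.2).

(** It vanishes exactly when some nontrivial combination of the two image vectors has both its first
    and its last coordinate zero. *)
Definition lie_det z : R := (P z).1.1 * (X z).2 - (X z).1.1 * (P z).2.

(* [A @: contact_space z] meets the hyperplanes [b = 0] and [a = 0] in the
   points [(1, p, 0)] and [(0, xi, 1)] with [(p, xi) = lie_map z]; by Cramer's
   rule the coefficients involve the inverse of [lie_det z]. *)
Definition lie_map z : 'rV[R]_n.+1 * 'rV[R]_n.+1 :=
  ((lie_det z)^-1 *: ((X z).2 *: (P z).1.2 + (- (P z).2) *: (X z).1.2),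
   (lie_det z)^-1 *: ((- (X z).1.1) *: (P z).1.2 + (P z).1.1 *: (X z).1.2)).

Lemma point_lie_map z : lie_det z != 0 ->
  point_vec (lie_map z).1 =
  (lie_det z)^-1 *: ((X z).2 *: P z + (- (P z).2) *: X z).
Proof.
move=> d0; congr (_, _, _) => /=; rewrite /GRing.scale /=.
  by rewrite mulNr (mulrC (P z).2) (mulrC (X z).2) -/(lie_det z) mulVf.
by rewrite mulNr mulrC (mulrC (P z).2) subrr mul0r.
Qed.

Lemma tangent_lie_map z : lie_det z != 0 ->
  tangent_vec (lie_map z).2 =
  (lie_det z)^-1 *: ((- (X z).1.1) *: P z + (P z).1.1 *: X z).
Proof.
move=> d0; congr (_, _, _) => /=; rewrite /GRing.scale /=.
  by rewrite mulNr mulrC (mulrC (P z).1.1) addNr mul0r.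
by rewrite mulNr addrC -/(lie_det z) mulVf.
Qed.

Lemma lie_map_pointE z : lie_det z != 0 ->
  P z = (P z).1.1 *: point_vec (lie_map z).1
        + (P z).2 *: tangent_vec (lie_map z).2.
Proof.
move=> d0; rewrite point_lie_map // tangent_lie_map //.
rewrite !scalerA !(mulrC _ (lie_det z)^-1) -!scalerA -scalerDr.
apply: (scalerI d0); rewrite scalerA divff // scale1r.
rewrite !scalerDr !scalerA addrACA -!scalerDl.
rewrite [X in _ + X *: _](_ : _ = 0); last by ring.
by rewrite scale0r addr0; congr (_ *: _); rewrite /lie_det; ring.
Qed.

Lemma lie_map_tangentE z : lie_det z != 0 ->
  X z = (X z).1.1 *: point_vec (lie_map z).1
        + (X z).2 *: tangent_vec (lie_map z).2.
Proof.
move=> d0; rewrite point_lie_map // tangent_lie_map //.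
rewrite !scalerA !(mulrC _ (lie_det z)^-1) -!scalerA -scalerDr.
apply: (scalerI d0); rewrite scalerA divff // scale1r.
rewrite !scalerDr !scalerA addrACA -!scalerDl.
rewrite [X in X *: _ + _](_ : _ = 0); last by ring.
by rewrite scale0r add0r; congr (_ *: _); rewrite /lie_det; ring.
Qed.

(** Cramer's formulas give one inclusion; the inverse relations [lie_map_pointE] and
    [lie_map_tangentE] give the other. *)
Lemma contact_space_lie_map z : lie_det z != 0 ->
  contact_space (lie_map z) = (A @: contact_space z)%VS.
Proof.
move=> d0; have memP : P z \in (A @: contact_space z)%VS.
  by apply/memv_img/mem_contact_spaceP; exists 1, 0; rewrite scale1r scale0r addr0.
have memX : X z \in (A @: contact_space z)%VS.
  by apply/memv_img/mem_contact_spaceP; exists 0, 1; rewrite scale1r scale0r add0r.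
apply/eqP; rewrite eqEsubv; apply/andP; split; apply/subvP => x.
  move=> /mem_contact_spaceP[s [t ->]]; rewrite point_lie_map ?tangent_lie_map //.
  by rewrite !(rpredD, rpredZ).
move=> /memv_imgP[y /mem_contact_spaceP[s [t ->]] ->].
rewrite linearD !linearZ /= -/(P z) -/(X z).
have mP : P z \in contact_space (lie_map z).
  apply/mem_contact_spaceP; exists (P z).1.1, (P z).2; exact: lie_map_pointE.
have mX : X z \in contact_space (lie_map z).
  apply/mem_contact_spaceP; exists (X z).1.1, (X z).2; exact: lie_map_tangentE.
by apply: rpredD; apply: rpredZ.
Qed.

Hypothesis A_null : null_preserving A.

(** Otherwise some nonzero [y] in the contact space would have [A y = (0, v, 0)]. This vector is
    null, so v.v = 0 and [A y = 0], against the injectivity of [A]. *)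
Lemma lie_det_neq0 z : lker A = 0%VS -> unit_tangent z -> lie_det z != 0.
Proof.
move=> kerA zT; apply/eqP => d0.
have Ainj : injective A by apply/lker0P; rewrite kerA.
have coef0 s t : s * (P z).1.1 + t * (X z).1.1 = 0 ->
    s * (P z).2 + t * (X z).2 = 0 -> s = 0 /\ t = 0.
  pose y := s *: point_vec z.1 + t *: tangent_vec z.2.
  move=> ha hb.
  have Ay : A y = s *: P z + t *: X z by rewrite /y linearD !linearZ.
  have Ay11 : (A y).1.1 = 0 by rewrite Ay -ha.
  have Ay2 : (A y).2 = 0 by rewrite Ay -hb.
  have /A_null : lie_form y y = 0.
    by apply: contact_space_null zT _; apply/mem_contact_spaceP; exists s, t.
  rewrite /lie_form Ay11 Ay2 !mulr0 subr0 oppr0 add0r => /dot_eq0 Ay12.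
  have : y = 0.
    apply: Ainj; rewrite linear0; case: (A y) Ay11 Ay12 Ay2 => [[a v] b] /=.
    by move=> -> -> ->.
  by rewrite /y contact_vecE => -[-> _ ->].
(* With zero determinant the rows of the adjugate solve both equations: first [(P z).2 = 0], then
   [(P z).1.1 = 0], after which the coefficients 1 and 0 solve them too, a contradiction. *)
have [] := coef0 (X z).2 (- (P z).2).
- by move: d0; rewrite /lie_det => d0; rewrite -[RHS]d0; ring.
- by ring.
move=> _ /eqP; rewrite oppr_eq0 => /eqP P2.
have [] := coef0 (- (X z).1.1) (P z).1.1.
- by ring.
- by move: d0; rewrite /lie_det => d0; rewrite -[RHS]d0; ring.
move=> _ P11.
have [] := coef0 1 0; rewrite ?P11 ?P2 ?mulr0 ?mul0r ?addr0 //.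
by move=> /eqP; rewrite oner_eq0.
Qed.

(** The image plane consists of images of null vectors, hence of null vectors; so the Gram matrix of
    its spanning vectors vanishes. *)
Lemma unit_tangent_lie_map z : lker A = 0%VS -> unit_tangent z ->
  unit_tangent (lie_map z).
Proof.
move=> kerA zT; have d0 := lie_det_neq0 kerA zT.
have null s t : lie_form
    (s *: point_vec (lie_map z).1 + t *: tangent_vec (lie_map z).2)
    (s *: point_vec (lie_map z).1 + t *: tangent_vec (lie_map z).2) = 0.
  set y := (_ + _); have : y \in contact_space (lie_map z).
    by apply/mem_contact_spaceP; exists s, t.
  rewrite contact_space_lie_map // => /memv_imgP[x xz ->].
  exact/A_null/(contact_space_null zT xz).
have h1 := null 1 0; have h2 := null 0 1; have h3 := null 1 1.
rewrite !lie_formE (lie_formC (tangent_vec _) (point_vec _)) lie_form_point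
  lie_form_tangent lie_form_point_tangent in h1 h2 h3.
move: (lie_map z) h1 h2 h3 => w; rewrite /unit_tangent /=.
move: (dot w.1 w.1) (dot w.2 w.2) (dot w.1 w.2).
by clear - R => a b c h1 h2 h3; split; lra.
Qed.

(* [<(1, p, 0), (0, xi, 1)> = p . xi], so this expresses [p(z) . xi(w)] through
   the pulled back Lie form; at [w = z] all the brackets vanish. *)
Lemma dot_lie_map : exists c, forall z w, lie_det z != 0 -> lie_det w != 0 ->
  dot (lie_map z).1 (lie_map w).2 =
  (lie_det z)^-1 * (lie_det w)^-1 * c *
  ((X z).2 * (- (X w).1.1 * (dot z.1 w.1 - 1) + (P w).1.1 * dot z.1 w.2)
   - (P z).2 * (- (X w).1.1 * dot z.2 w.1 + (P w).1.1 * (dot z.2 w.2 - 1))).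
Proof.
have [c Ac] := lie_form_conformal A_null; exists c => z w dz dw.
rewrite -lie_form_point_tangent point_lie_map // tangent_lie_map //.
rewrite !lie_formE !Ac (lie_formC (tangent_vec _) (point_vec _)).
by rewrite lie_form_point lie_form_tangent !lie_form_point_tangent (dotC w.1); ring.
Qed.

End LieMap.

(** Both sides span the same plane, because [B] undoes [A], and [contact_space] is injective. *)
Lemma lie_mapK (R : realType) (n : nat) (A B : 'End(lie_vec R n))
    (z : 'rV[R]_n.+1 * 'rV[R]_n.+1) :
  cancel A B -> lie_det A z != 0 -> lie_det B (lie_map A z) != 0 ->
  lie_map B (lie_map A z) = z.
Proof.
move=> AK dA dB; apply: contact_space_inj.
rewrite !contact_space_lie_map // -limg_comp.
rewrite -[RHS](lim1g (contact_space z)); apply: eq_in_limg => x _.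
by rewrite comp_lfunE id_lfunE AK.
Qed.

(** * Smoothness and the contact condition *)

Section LieMapCalculus.
Variables (R : realType) (n : nat) (V : normedModType R).
Let T := ('rV[R]_n.+1 * 'rV[R]_n.+1)%type.
Implicit Types (f : V -> T) (x v : V).

Section Affine.
Variables (W : normedModType R) (L : lie_vec R n -> W).
Hypothesis linL : linear L.

Let Lp (p : 'rV[R]_n.+1) := L (0, p, 0).

Let linLp : linear Lp.
Proof.
move=> a u w; rewrite /Lp -linL; congr L; congr (_, _, _) => /=.
  by rewrite scaler0 addr0.
by rewrite scaler0 addr0.
Qed.

(** [point_vec] is affine, not linear: a constant is split off, and the remaining [Lp] is linear on
    row vectors, hence continuous. *)
Let L_point p : L (point_vec p) = Lp p + L (point_vec 0).
Proof.
rewrite -[Lp p]scale1r -linL; congr L; congr (_, _, _) => /=.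
- by rewrite scaler0 add0r.
- by rewrite scale1r addr0.
- by rewrite scaler0 add0r.
Qed.

Let L_tangent p : L (tangent_vec p) = Lp p + L (tangent_vec 0).
Proof.
rewrite -[Lp p]scale1r -linL; congr L; congr (_, _, _) => /=.
- by rewrite scaler0 add0r.
- by rewrite scale1r addr0.
- by rewrite scaler0 add0r.
Qed.

Lemma Ck_on_point_vec k (U : set V) f : open U -> Ck_on k U f ->
  Ck_on k U (fun y => L (point_vec (f y).1)).
Proof.
move=> Uo Cf; under eq_fun do rewrite L_point.
apply: Ck_onD => //; last exact: Ck_on_cst.
apply: (Ck_on_linear (g := Lp)) => //; first exact: rV_linear_continuous.
by apply: (Ck_on_linear (g := fst)) Cf => // y; exact: cvg_fst.
Qed.

Lemma Ck_on_tangent_vec k (U : set V) f : open U -> Ck_on k U f ->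
  Ck_on k U (fun y => L (tangent_vec (f y).2)).
Proof.
move=> Uo Cf; under eq_fun do rewrite L_tangent.
apply: Ck_onD => //; last exact: Ck_on_cst.
apply: (Ck_on_linear (g := Lp)) => //; first exact: rV_linear_continuous.
by apply: (Ck_on_linear (g := snd)) Cf => // y; exact: cvg_snd.
Qed.

Lemma is_derive_point_vec f x v df : is_derive x v f df ->
  is_derive x v (fun y => L (point_vec (f y).1)) (L (0, df.1, 0)).
Proof.
move=> fd; under eq_fun do rewrite L_point.
rewrite -[L (0, _, 0)]addr0; apply: is_deriveD.
apply: (is_derive_linear (g := Lp)) => //; first exact: rV_linear_continuous.
by apply: (is_derive_linear (g := fst)) fd => // y; exact: cvg_fst.
Qed.

Lemma is_derive_tangent_vec f x v df : is_derive x v f df ->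
  is_derive x v (fun y => L (tangent_vec (f y).2)) (L (0, df.2, 0)).
Proof.
move=> fd; under eq_fun do rewrite L_tangent.
rewrite -[L (0, _, 0)]addr0; apply: is_deriveD.
apply: (is_derive_linear (g := Lp)) => //; first exact: rV_linear_continuous.
by apply: (is_derive_linear (g := snd)) fd => // y; exact: cvg_snd.
Qed.

End Affine.

Variable A : 'End(lie_vec R n).

Let fstL (x : lie_vec R n) : R^o := (A x).1.1.
Let midL (x : lie_vec R n) : 'rV[R]_n.+1 := (A x).1.2.
Let lstL (x : lie_vec R n) : R^o := (A x).2.

Let fstL_linear : linear fstL.
Proof. by move=> a u w; rewrite /fstL linearP. Qed.
Let midL_linear : linear midL.
Proof. by move=> a u w; rewrite /midL linearP. Qed.
Let lstL_linear : linear lstL.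
Proof. by move=> a u w; rewrite /lstL linearP. Qed.

Let Ck_onN k (U : set V) (W : normedModType R) (g : V -> W) : open U ->
  Ck_on k U g -> Ck_on k U (fun y => - g y).
Proof.
move=> Uo Cg; apply: (Ck_on_linear (g := fun w : W => - w)) => //.
  by move=> a u w; rewrite opprD scalerN.
exact: opp_continuous.
Qed.

Lemma Ck_on_lie_det k (U : set V) f : open U -> Ck_on k U f ->
  Ck_on k U (fun y => lie_det A (f y) : R^o).
Proof.
move=> Uo Cf; apply: Ck_onD => //.
  apply: (Ck_onZ (a := fun y => fstL (point_vec (f y).1))
                 (w := fun y => lstL (tangent_vec (f y).2))) => //.
    exact: Ck_on_point_vec.
  exact: Ck_on_tangent_vec.
apply: Ck_onN => //.
apply: (Ck_onZ (a := fun y => fstL (tangent_vec (f y).2))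
               (w := fun y => lstL (point_vec (f y).1))) => //.
  exact: Ck_on_tangent_vec.
exact: Ck_on_point_vec.
Qed.

Lemma Ck_on_lie_map k (U : set V) f : open U -> Ck_on k U f ->
  (forall y, U y -> lie_det A (f y) != 0) ->
  Ck_on k U (fun y => lie_map A (f y)).
Proof.
move=> Uo Cf d0; apply: Ck_on_pair => //.
  apply: (Ck_onZ (a := fun y => (lie_det A (f y))^-1)) => //.
    by apply: Ck_on_inv => //; exact: Ck_on_lie_det.
  apply: Ck_onD => //.
    apply: (Ck_onZ (a := fun y => lstL (tangent_vec (f y).2))
                   (w := fun y => midL (point_vec (f y).1))) => //.
      exact: Ck_on_tangent_vec.
    exact: Ck_on_point_vec.
  apply: (Ck_onZ (a := fun y => - lstL (point_vec (f y).1))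
                 (w := fun y => midL (tangent_vec (f y).2))) => //.
    by apply: Ck_onN => //; exact: Ck_on_point_vec.
  exact: Ck_on_tangent_vec.
apply: (Ck_onZ (a := fun y => (lie_det A (f y))^-1)) => //.
  by apply: Ck_on_inv => //; exact: Ck_on_lie_det.
apply: Ck_onD => //.
  apply: (Ck_onZ (a := fun y => - fstL (tangent_vec (f y).2))
                 (w := fun y => midL (point_vec (f y).1))) => //.
    by apply: Ck_onN => //; exact: Ck_on_tangent_vec.
  exact: Ck_on_point_vec.
apply: (Ck_onZ (a := fun y => fstL (point_vec (f y).1))
               (w := fun y => midL (tangent_vec (f y).2))) => //.
  exact: Ck_on_point_vec.
exact: Ck_on_tangent_vec.
Qed.

Lemma is_derive_lie_det f x v df : is_derive x v f df ->
  is_derive x v (fun y => lie_det A (f y) : R)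
    (fstL (point_vec (f x).1) * lstL (0, df.2, 0)
     + fstL (0, df.1, 0) * lstL (tangent_vec (f x).2)
     - (fstL (tangent_vec (f x).2) * lstL (0, df.1, 0)
        + fstL (0, df.2, 0) * lstL (point_vec (f x).1))).
Proof.
move=> fd; apply: is_deriveB.
  apply: (is_derive_scale (w := fun y => lstL (tangent_vec (f y).2))).
    exact: (is_derive_point_vec fstL_linear fd).
  exact: is_derive_tangent_vec.
apply: (is_derive_scale (w := fun y => lstL (point_vec (f y).1))).
  exact: (is_derive_tangent_vec fstL_linear fd).
exact: is_derive_point_vec.
Qed.

Let L00 (W : normedModType R) (L : lie_vec R n -> W) : linear L ->
  L (0, 0, 0) = 0.
Proof.
move=> linL; have := linL (-1) (0, 0, 0) (0, 0, 0).
rewrite [X in L X](_ : _ = (0, 0, 0)) => [->|]; first by rewrite scaleN1r addNr.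
by congr (_, _, _); rewrite /= scaler0 addr0.
Qed.

Let is_derive0Z (W : normedModType R) (a : V -> R) (w : V -> W) x v :
  is_derive x v a 0 -> is_derive x v w 0 ->
  is_derive x v (fun y => a y *: w y) 0.
Proof.
move=> ad wd; apply: is_derive_eq (is_derive_scale ad wd) _.
by rewrite scaler0 scale0r addr0.
Qed.

Let is_derive0D (W : normedModType R) (u w : V -> W) x v :
  is_derive x v u 0 -> is_derive x v w 0 ->
  is_derive x v (fun y => u y + w y) 0.
Proof.
by move=> ud wd; apply: is_derive_eq (is_deriveD ud wd) _; rewrite addr0.
Qed.

Let is_derive0N (W : normedModType R) (u : V -> W) x v :
  is_derive x v u 0 -> is_derive x v (fun y => - u y) 0.
Proof. by move=> ud; apply: is_derive_eq (is_deriveN ud) _; rewrite oppr0. Qed.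

(** The case of the chain rule that controls kernels: every factor in the formula for [lie_map] has
    derivative zero in direction [v]. *)
Lemma is_derive0_lie_map f x v : lie_det A (f x) != 0 ->
  is_derive x v f 0 -> is_derive x v (fun y => lie_map A (f y)) 0.
Proof.
move=> d0 fd.
have dP (W : normedModType R) (L : lie_vec R n -> W) : linear L ->
    is_derive x v (fun y => L (point_vec (f y).1)) 0.
  by move=> lL; apply: is_derive_eq (is_derive_point_vec lL fd) (L00 lL).
have dX (W : normedModType R) (L : lie_vec R n -> W) : linear L ->
    is_derive x v (fun y => L (tangent_vec (f y).2)) 0.
  by move=> lL; apply: is_derive_eq (is_derive_tangent_vec lL fd) (L00 lL).
have dD : is_derive x v (fun y => (lie_det A (f y))^-1) 0.
  have H := is_derive_inv (a := fun y => lie_det A (f y)) d0 (is_derive_lie_det fd).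
  apply: (is_derive_eq (W := R^o) H).
  rewrite [(0 : T).1]/(0 : 'rV_n.+1) [(0 : T).2]/(0 : 'rV_n.+1).
  by rewrite (L00 fstL_linear) (L00 lstL_linear); ring.
apply: is_derive_pair.
  apply: (is_derive0Z (w := fun y => lstL (tangent_vec (f y).2) *:
    midL (point_vec (f y).1) + (- lstL (point_vec (f y).1)) *:
    midL (tangent_vec (f y).2))) => //.
  apply: is_derive0D.
    exact: (is_derive0Z (dX _ _ lstL_linear) (dP _ _ midL_linear)).
  exact: (is_derive0Z (is_derive0N (dP _ _ lstL_linear)) (dX _ _ midL_linear)).
apply: (is_derive0Z (w := fun y => (- fstL (tangent_vec (f y).2)) *:
  midL (point_vec (f y).1) + fstL (point_vec (f y).1) *:
  midL (tangent_vec (f y).2))) => //.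
apply: is_derive0D.
  exact: (is_derive0Z (is_derive0N (dX _ _ fstL_linear)) (dP _ _ midL_linear)).
exact: (is_derive0Z (dP _ _ fstL_linear) (dX _ _ midL_linear)).
Qed.

Lemma is_derive_dot m (g h : V -> 'rV[R]_m) x v dg dh :
  is_derive x v g dg -> is_derive x v h dh ->
  is_derive x v (fun y => dot (g y) (h y)) (dot dg (h x) + dot (g x) dh).
Proof.
move=> gd hd.
have coord (k : V -> 'rV[R]_m) dk i : is_derive x v k dk ->
    is_derive x v (fun y => k y ord0 i) (dk ord0 i).
  apply: (is_derive_linear (W' := R^o) (g := fun w : 'rV[R]_m => w ord0 i)).
    by move=> a u w; rewrite !mxE.
  exact: coord_continuous.
have -> : (fun y => dot (g y) (h y)) =
    \sum_(i < m) (fun y => g y ord0 i *: (h y ord0 i : R^o)).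
  by apply/funext => y; rewrite fct_sumE.
have prodd i := is_derive_scale (coord _ _ i gd) (coord _ _ i hd).
by apply: (is_derive_eq (is_derive_sum prodd)); rewrite big_split addrC.
Qed.

Hypothesis A_null : null_preserving A.
Hypothesis kerA : lker A = 0%VS.

(** With the second argument frozen at [x], the function p'(y).xi'(x) of y has derivative dp'.xi' at
    [x]. In its expression by [dot_lie_map], each bracket vanishes at [x] together with its
    derivative in direction [v]. *)
Lemma lie_map_contact f x v df df' :
  (forall y, unit_tangent (f y)) -> is_derive x v f df ->
  is_derive x v (fun y => lie_map A (f y)) df' ->
  dot df.1 (f x).2 = 0 -> dot df'.1 (lie_map A (f x)).2 = 0.
Proof.
move=> fT fd f'd contact.
have fst_d : is_derive x v (fun y => (f y).1) df.1.
  by apply: (is_derive_linear (g := fst)) fd => // y; exact: cvg_fst.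
have snd_d : is_derive x v (fun y => (f y).2) df.2.
  by apply: (is_derive_linear (g := snd)) fd => // y; exact: cvg_snd.
have dot_cst m (g h : V -> 'rV[R]_m) dg dh c : is_derive x v g dg ->
    is_derive x v h dh -> (forall y, dot (g y) (h y) = c) ->
    dot dg (h x) + dot (g x) dh = 0.
  move=> gd hd ghc; have [_ <-] := is_derive_dot gd hd.
  by under eq_fun do rewrite ghc; exact: derive_cst.
(* The relations p.p = 1, xi.xi = 1 and p.xi = 0 are differentiated; the last, with the contact
   condition, gives dxi.p = 0. *)
have h11 : dot df.1 (f x).1 = 0.
  have := dot_cst _ _ _ _ _ 1 fst_d fst_d (fun y => ltac:(by case: (fT y))).
  by rewrite (dotC (f x).1) -mulr2n => /eqP; rewrite mulrn_eq0 => /eqP.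
have h22 : dot df.2 (f x).2 = 0.
  have := dot_cst _ _ _ _ _ 1 snd_d snd_d (fun y => ltac:(by case: (fT y))).
  by rewrite (dotC (f x).2) -mulr2n => /eqP; rewrite mulrn_eq0 => /eqP.
have h21 : dot df.2 (f x).1 = 0.
  have := dot_cst _ _ _ _ _ 0 fst_d snd_d (fun y => ltac:(by case: (fT y))).
  by rewrite contact add0r dotC.
have d0 y : lie_det A (f y) != 0 by exact: lie_det_neq0.
have [c Fdot] := dot_lie_map A_null.
have dotd m (g : V -> 'rV[R]_m) dg w : is_derive x v g dg ->
    is_derive x v (fun y => dot (g y) w) (dot dg w).
  move=> gd; apply: is_derive_eq (is_derive_dot gd (is_derive_cst w x v)) _.
  by rewrite dot0r addr0.
(* When [m] and its derivative vanish at [x], the product has derivative zero whatever [da] is. *)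
have mult0 (a m : V -> R) da : is_derive x v a da -> is_derive x v m 0 ->
    m x = 0 -> is_derive x v (fun y => a y *: (m y : R^o)) 0.
  move=> ad md m0; apply: is_derive_eq (is_derive_scale (w := m : V -> R^o) ad md) _.
  by rewrite m0 !scaler0 addr0.
have fst'd : is_derive x v (fun y => (lie_map A (f y)).1) df'.1.
  by apply: (is_derive_linear (g := fst)) f'd => // y; exact: cvg_fst.
have [_ <-] := dotd _ _ _ (lie_map A (f x)).2 fst'd.
under eq_fun do rewrite Fdot //.
case: (fT x) => f11 f22 f12.
set a := (A (tangent_vec (f x).2)).1.1; set b := (A (point_vec (f x).1)).1.1.
(* For [w = f x] the two brackets of [dot_lie_map] are affine in [z]: they equal [dot z.1 w0 + a]
   and [dot z.2 w0 - b]. *)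
pose w0 : 'rV[R]_n.+1 := (- a) *: (f x).1 + b *: (f x).2.
pose m1 y := dot (f y).1 w0 + a.
pose m2 y := dot (f y).2 w0 - b.
have m10 : m1 x = 0 by rewrite /m1 dotDr !dotZr f11 f12; ring.
have m20 : m2 x = 0 by rewrite /m2 dotDr !dotZr f22 dotC f12; ring.
have m1d : is_derive x v m1 0.
  have H := is_deriveD (dotd _ _ _ w0 fst_d) (is_derive_cst a x v).
  by apply: (is_derive_eq H); rewrite dotDr !dotZr h11 contact !mulr0 !addr0.
have m2d : is_derive x v m2 0.
  have H := is_deriveD (dotd _ _ _ w0 snd_d) (is_derive_cst (- b) x v).
  by apply: (is_derive_eq H); rewrite dotDr !dotZr h21 h22 !mulr0 !addr0.
have [_ <-] : is_derive x v (fun y => (lie_det A (f y))^-1 *: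
    (((lie_det A (f x))^-1 * c) *:
     ((A (tangent_vec (f y).2)).2 *: (m1 y : R^o) -
      (A (point_vec (f y).1)).2 *: (m2 y : R^o)))) 0.
  apply: (mult0).
  - exact: (is_derive_inv (a := fun y => lie_det A (f y)) (d0 x)
      (is_derive_lie_det fd)).
  - have H1 := mult0 _ _ _ (is_derive_tangent_vec lstL_linear fd) m1d m10.
    have H2 := mult0 _ _ _ (is_derive_point_vec lstL_linear fd) m2d m20.
    have H := is_deriveZ ((lie_det A (f x))^-1 * c) (is_deriveB H1 H2).
    by apply: (is_derive_eq H); rewrite subr0 scaler0.
  - by rewrite m10 m20 !scaler0 subr0 scaler0.
congr ('D_v _ x); apply/funext => y.
by rewrite /m1 /m2 !dotDr !dotZr /GRing.scale /=; ring.
Qed.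

End LieMapCalculus.

(** * Action on local parametrizations *)

Section LieMapGeometry.
Variables (R : realType) (n : nat).
Let T := ('rV[R]_n.+1 * 'rV[R]_n.+1)%type.
Variables A B : 'End(lie_vec R n).
Hypotheses (A_null : null_preserving A) (B_null : null_preserving B).
Hypotheses (kerA : lker A = 0%VS) (kerB : lker B = 0%VS).
Hypotheses (AK : cancel A B) (BK : cancel B A).

Lemma lie_map_unitK z : unit_tangent z -> lie_map B (lie_map A z) = z.
Proof.
move=> zT; apply: lie_mapK => //; apply: lie_det_neq0 => //.
exact: unit_tangent_lie_map.
Qed.

(** On [U], [f] is [lie_map B] applied to the composite, so a direction killed by the composite is
    killed by [f]. Openness of [U] turns this equality on [U] into one of derivatives. *)
Lemma lie_map_immersive (V : normedModType R) (U : set V) (f : V -> T) x v :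
  open U -> smooth_on U f -> (forall y, U y -> unit_tangent (f y)) -> U x ->
  'D_v (fun y => lie_map A (f y)) x = 0 -> 'D_v f x = 0.
Proof.
move=> Uo Cf fT Ux D0.
have d0 y : U y -> lie_det A (f y) != 0 by move=> /fT; exact: lie_det_neq0.
have f'd := Ck_on_derive v (Ck_on_lie_map Uo (Cf 1%N) d0) Ux.
rewrite D0 in f'd.
have d0' : lie_det B (lie_map A (f x)) != 0.
  by apply: lie_det_neq0 => //; exact/unit_tangent_lie_map/fT.
have [_ <-] := is_derive0_lie_map (f := fun y => lie_map A (f y)) d0' f'd.
apply: near_eq_derive; apply: filterS (open_nbhs_nbhs (conj Uo Ux)) => y Uy.
by rewrite lie_map_unitK //; exact: fT.
Qed.

(** Local parametrizations refer to open sets of the ambient product, where continuity of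
    [lie_map A] is known off the zeros of [lie_det A]; hence the determinant condition in the
    set. *)
Lemma open_lie_map_preimage (O : set T) : open O ->
  open [set z | lie_det A z != 0 /\ O (lie_map A z)].
Proof.
move=> Oo.
have Do : open [set z | lie_det A z != 0].
  rewrite openE => z dz.
  have dc : {for z, continuous (lie_det A : T -> R^o)}.
    by apply: (Ck_on_continuous (Ck_on_lie_det A openT (Ck_on_id 0 openT))).
  by apply: (dc [set r | r != 0]); apply: open_nbhs_nbhs; split=> //; exact: open_neq.
rewrite openE => z [dz Oz]; apply: filterI.
  by apply: open_nbhs_nbhs; split.
have Fc : {for z, continuous (lie_map A : T -> T)}.
  exact: (Ck_on_continuous (Ck_on_lie_map Do (Ck_on_id 0 Do) (fun _ => id)) dz).
by apply: Fc; apply: open_nbhs_nbhs; split.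
Qed.

End LieMapGeometry.

(** On the unit tangent bundle [lie_map A] and [lie_map B] are mutually inverse, and each clause is
    transported through this pair. *)
Lemma local_parametrization_lie_map (R : realType) (n : nat)
    (A B : 'End(lie_vec R n)) (U : set 'rV[R]_(2 * n).-1)
    (phi : 'rV[R]_(2 * n).-1 -> 'rV[R]_n.+1 * 'rV[R]_n.+1) :
  null_preserving A -> null_preserving B -> lker A = 0%VS -> lker B = 0%VS ->
  cancel A B -> cancel B A -> local_parametrization U phi ->
  local_parametrization U (fun u => lie_map B (phi u)).
Proof.
move=> A_null B_null kerA kerB AK BK [Uo Cphi dphi phi_inj phi_open].
have phiT y : U y -> unit_tangent (phi y).
  (* The last clause, taken at [V = U], places the values of [phi] in the unit tangent bundle. *)
  move=> Uy; have [N _ NT] := phi_open U Uo (@subset_refl _ _).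
  by have [] : (N `&` @unit_tangent R n) (phi y) by rewrite -NT; exists y.
have d0 y : U y -> lie_det B (phi y) != 0 by move=> /phiT; exact: lie_det_neq0.
split.
- exact: Uo.
- by move=> k; exact: Ck_on_lie_map.
- move=> u Uu v Dv; apply: (dphi u Uu).
  exact: (lie_map_immersive B_null A_null kerB kerA BK Uo Cphi phiT Uu Dv).
- move=> u u' Uu Uu' /(congr1 (lie_map A)).
  by rewrite !(lie_map_unitK B_null A_null) //; [exact: phi_inj|exact: phiT..].
- move=> V Vo VU; have [N No NT] := phi_open V Vo VU.
  (* An image under [lie_map B] is a preimage under its inverse [lie_map A]. *)
  exists [set z | lie_det A z != 0 /\ N (lie_map A z)].
    exact: open_lie_map_preimage.
  apply/seteqP; split=> [_ [u Vu <-]|z [[dz Oz] zT]].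
    have Uu := VU _ Vu; have phiTu := phiT u Uu.
    have zT := unit_tangent_lie_map B_null kerB phiTu.
    split=> //; split; first exact: lie_det_neq0.
    rewrite (lie_map_unitK B_null A_null) //.
    by have [] : (N `&` @unit_tangent R n) (phi u) by rewrite -NT; exists u.
  have [u Vu uz] : (phi @` V) (lie_map A z).
    by rewrite NT; split=> //; exact: unit_tangent_lie_map.
  by exists u => //; rewrite uz (lie_map_unitK A_null B_null).
Qed.

(** * Lie sphere transformations acting on points and lines *)

Section LieSphere.
Variables (R : realType) (n : nat) (alpha : proj_point R n -> proj_point R n).
Variable A : 'End(lie_vec R n).
Hypothesis kerA : lker A = 0%VS.
Hypothesis alphaE : forall p, sval (alpha p) = (A @: sval p)%VS.

Let AK : cancel A A^-1%VF. Proof. by apply: lker0_lfunK; rewrite kerA. Qed.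
Let AVK : cancel A^-1%VF A. Proof. by apply: lker0_lfunVK; rewrite kerA. Qed.

Lemma lker_inv : lker A^-1%VF = 0%VS.
Proof. by apply/eqP/lker0P; exact: can_inj AVK. Qed.

Let limgK (U : {vspace lie_vec R n}) : (A @: (A^-1%VF @: U))%VS = U.
Proof.
rewrite -limg_comp -[RHS]lim1g; apply: eq_in_limg => x _.
by rewrite comp_lfunE id_lfunE AVK.
Qed.

Lemma proj_map_inj : injective alpha.
Proof.
move=> p q /(congr1 sval); rewrite !alphaE => /eqP.
by rewrite eq_limg_ker0 ?kerA // => /eqP; exact: val_inj.
Qed.

(** Surjectivity: the antecedent of a point [q] is its inverse image under [A], again of dimension
    one by injectivity. *)
Lemma image_projectivization (U : {vspace lie_vec R n}) :
  alpha @` projectivization U = projectivization (A @: U)%VS.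
Proof.
apply/seteqP; split=> [_ [p pU <-]|q qU].
  by rewrite /projectivization /= alphaE; exact: limgS.
have dimq : \dim (A^-1%VF @: sval q)%VS == 1%N.
  by rewrite limg_dim_eq ?(svalP q) // lker_inv capv0.
exists (exist _ (A^-1%VF @: sval q)%VS dimq).
  by rewrite /projectivization /= -(limg_ker0 (f := A)) ?kerA // limgK.
by apply: val_inj; rewrite /= alphaE limgK.
Qed.

Let point (x : lie_vec R n) (x0 : x != 0) : proj_point R n.
Proof. by exists <[x]>%VS; rewrite dim_vline x0. Defined.

Let quadric_point (x : lie_vec R n) (x0 : x != 0) :
  lie_form x x = 0 -> lie_quadric R n (point x0).
Proof.
by move=> xx _ /vlineP[k ->]; rewrite lie_formZl lie_formZr xx !mulr0.
Qed.

Let null0 (x : lie_vec R n) : x = 0 -> lie_form x x = 0.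
Proof. by move=> ->; rewrite -(scale0r 0) lie_formZl mul0r. Qed.

Hypothesis alphaQ : alpha @` lie_quadric R n = lie_quadric R n.

(** A nonzero null vector spans a point of the quadric, which [alpha] keeps there; the zero vector
    spans no point and is treated apart. *)
Lemma lie_sphere_null : null_preserving A.
Proof.
move=> x xx; have [->|x0] := eqVneq x 0; first by rewrite null0 ?linear0.
have : lie_quadric R n (alpha (point x0)).
  by rewrite -alphaQ; exists (point x0) => //; exact: quadric_point.
by apply; rewrite alphaE; exact/memv_img/memv_line.
Qed.

(** This uses the other inclusion in [alphaQ]: each point of the quadric is the image of one whose
    vectors are null. *)
Lemma lie_sphere_inv_null : null_preserving A^-1%VF.
Proof.
move=> x xx; have [->|x0] := eqVneq x 0; first by rewrite null0 ?linear0.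
have [p pQ px] : (alpha @` lie_quadric R n) (point x0).
  by rewrite alphaQ; exact: quadric_point.
have : x \in sval (alpha p) by rewrite px memv_line.
by rewrite alphaE => /memv_imgP[y yp ->]; rewrite AK; exact: pQ.
Qed.

Lemma image_contact_line z : unit_tangent z ->
  alpha @` contact_line z = contact_line (lie_map A z).
Proof.
move=> zT; rewrite !contact_lineE image_projectivization.
by rewrite contact_space_lie_map //; exact: (lie_det_neq0 lie_sphere_null).
Qed.

End LieSphere.

(** * Transport of Lie-tautness *)

Lemma Lambda_contact_line (R : realType) (n : nat)
    (z : 'rV[R]_n.+1 * 'rV[R]_n.+1) :
  unit_tangent z -> Lambda R n (contact_line z).
Proof.
move=> zT; split.
  by exists (contact_space z); [exact: dim_contact_space|exact: contact_lineE].
by move=> p /subvP pz x /pz; exact: contact_space_null.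
Qed.

Theorem mainTheorem3 (R : realType) (n : nat) (hn : (0 < n)%N)
    (B : manifold R n.-1) (lambda : B -> set (proj_point R n))
    (alpha : proj_point R n -> proj_point R n)
    (hlambda : lie_taut lambda)
    (halpha : lie_sphere_transformation alpha) :
  lie_taut (lie_image alpha lambda).
Proof.
case: hlambda => Bcompact [f [fT lambdaE [fC f_imm] f_contact]] taut.
case: halpha => -[A kerA alphaE] alphaQ.
have A_null := lie_sphere_null alphaE alphaQ.
have A'_null := lie_sphere_inv_null kerA alphaE alphaQ.
have kerA' := lker_inv kerA.
have AK : cancel A A^-1%VF by apply: lker0_lfunK; rewrite kerA.
have AVK : cancel A^-1%VF A by apply: lker0_lfunVK; rewrite kerA.
have imageE := image_contact_line kerA alphaE alphaQ.
have cod_open c : atlas B c -> open (chart_cod c).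
  by move=> /atlas_homeo[].
split=> //.
- have d0 b : lie_det A (f b) != 0 by exact: lie_det_neq0.
  exists (fun b => lie_map A (f b)); split.
  + by move=> b; exact: unit_tangent_lie_map.
  + by move=> b; rewrite /lie_image lambdaE imageE.
  + split=> [c cB k|c cB u cu v Dv].
      by apply: Ck_on_lie_map; [exact: cod_open|exact: fC|move=> *; exact: d0].
    apply: (f_imm c cB u cu).
    apply: (lie_map_immersive A_null A'_null kerA kerA' AK (cod_open c cB)
      (fC c cB) _ cu Dv).
    by move=> y _; exact: fT.
  + move=> c cB u cu v.
    have Cfc := fC c cB 1%N.
    have fd := Ck_on_derive v Cfc cu.
    have f'd := Ck_on_derive v
      (Ck_on_lie_map (A := A) (cod_open c cB) Cfc (fun y _ => d0 _)) cu.
    apply: (lie_map_contact A_null kerA _ fd f'd); first by move=> y; exact: fT.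
    exact: f_contact.
- move=> U phi phiP e e0.
  (* The line at [u] through [phi] is the [alpha]-image of the line at [u] through this
     parametrization, so boxes covering the exceptional set of [lambda] here cover that of its image
     in [phi]. *)
  have phi'P := local_parametrization_lie_map A_null A'_null kerA kerA' AK AVK phiP.
  have [a [b [ab cover small]]] := taut _ _ phi'P e e0.
  exists a, b; split=> //; apply: subset_trans cover => u [Uu [_ nocount]].
  split=> //; have phiT : unit_tangent (phi u).
    case: phiP => Uo _ _ _ /(_ U Uo (@subset_refl _ _))[N _ NT].
    by have [] : (N `&` @unit_tangent R n) (phi u) by rewrite -NT; exists u.
  have phi'T := unit_tangent_lie_map A'_null kerA' phiT.
  split; first exact: Lambda_contact_line.
  move=> [m count half]; apply: nocount; exists m => //.
  (* The two sets of points of [B] coincide, so the count and its relation to the Betti number carry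
     over. *)
  suff -> : [set b | lie_image alpha lambda b `&` contact_line (phi u) !=set0] =
    [set b | lambda b `&` contact_line (lie_map A^-1%VF (phi u)) !=set0] by [].
  (* The line at [phi u] becomes an image under [alpha]; injectivity of [alpha] then matches the
     intersection points. *)
  rewrite -[in LHS](lie_map_unitK A'_null A_null kerA' kerA AVK phiT) -imageE //.
  apply/seteqP; split=> x /=; rewrite /lie_image.
    move=> [_ [[p px <-] [q ql /(proj_map_inj kerA alphaE) qp]]].
    by exists p; split=> //; rewrite -qp.
  by move=> [p [px pl]]; exists (alpha p); split; exists p.
Qed.
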